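(* Let $A\in\mathbb{C}^{n\times n}$ with $\mathrm{Ind}(A)=k$. Then the core-EP inverse $A^{\mathrm{cEP}}$ of $A$ is the unique solution $X$ of the system $$XAX=X,\qquad AX=AA^D(AA^D)^\dagger,\qquad XA=A^D(AA^D)^\dagger A,$$ and $A^{\mathrm{cEP}}$ can be written as $$A^{\mathrm{cEP}}=A^{(A^D)}=A^D(AA^D)^\dagger.$$
   Context: $M^*$ and $M^\dagger$ denote the conjugate transpose and the Moore-Penrose inverse of a complex matrix $M$. $\mathrm{Ind}(A)$ is the smallest nonnegative integer $k$ with $\mathrm{rk}(A^{k+1})=\mathrm{rk}(A^k)$. $A^D$ is the Drazin inverse of $A$: the unique $X$ with $XAX=X$, $AX=XA$, $XA^{k+1}=A^k$, where $k=\mathrm{Ind}(A)$. The core-EP inverse of $A$ with $\mathrm{Ind}(A)=k$ is $A^{\mathrm{cEP}}:=A^k\bigl((A^* )^kA^{k+1}\bigr)^\dagger(A^* )^k$. For $A,B\in\mathbb{C}^{n\times n}$, the generalized inverse of $A$ with respect to $B$ is $A^{(B)}:=(ABB^\dagger)^\dagger$. *)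

(* Defs.v *)
From HB Require Import structures.
From mathcomp Require Export all_boot all_order all_algebra.
From mathcomp Require Export complex reals.

Set Implicit Arguments.
Unset Strict Implicit.
Unset Printing Implicit Defensive.

Import Order.TTheory GRing.Theory Num.Theory.
Local Open Scope ring_scope.
Local Open Scope sesquilinear_scope.

Section MoorePenrose.
Variable C : numClosedFieldType.

(* The four Penrose equations; [^t*] is the conjugate transpose of spectral.v.
   Boolean, so that [xchoose] selects the unique solution constructively. *)
Definition penrose m n (M : 'M[C]_(m, n)) (X : 'M[C]_(n, m)) : bool :=
  [&& M *m X *m M == M, X *m M *m X == X,
      (M *m X)^t* == M *m X & (X *m M)^t* == X *m M].

Lemma trmxC_mul m n p (A : 'M[C]_(m, n)) (B : 'M[C]_(n, p)) :
  (A *m B)^t* = B^t* *m A^t*.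
Proof. by rewrite trmx_mul map_mxM. Qed.

Lemma gram_unitmx r n (G : 'M[C]_(r, n)) :
  row_free G -> G *m G^t* \in unitmx.
Proof.
move=> freeG; rewrite -row_free_unit -kermx_eq0.
apply/rowV0P => u /sub_kermxP; rewrite mulmxA => uGG0.
have uG0 : u *m G = 0.
  apply/eqP; rewrite -(dnorm_eq0 (@dotmx C n)).
  by have /= -> := dotmxE (u *m G) (u *m G); rewrite trmxC_mul mulmxA uGG0 mul0mx mxE.
by apply/eqP; rewrite -(mulmx_free_eq0 _ freeG) uG0.
Qed.

Lemma penrose_exists m n (M : 'M[C]_(m, n)) : exists X, penrose M X.
Proof.
have [r [F [G [MFG fullF freeG]]]] : exists r (F : 'M_(m, r)) (G : 'M_(r, n)),
    [/\ M = F *m G, row_full F & row_free G].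
  exists (\rank M), (col_base M), (row_base M).
  by rewrite mulmx_base col_base_full row_base_free.
have uP : G *m G^t* \in unitmx by exact: gram_unitmx.
have uQ : F^t* *m F \in unitmx.
  rewrite -{2}[F]trmxCK; apply: gram_unitmx.
  by rewrite /row_free mxrank_map mxrank_tr.
have PI : G *m G^t* *m invmx (G *m G^t*) = 1%:M by rewrite mulmxV.
have QI : invmx (F^t* *m F) *m (F^t* *m F) = 1%:M by rewrite mulVmx.
have hP : (G *m G^t*)^t* = G *m G^t* by rewrite trmxC_mul trmxCK.
have hQ : (F^t* *m F)^t* = F^t* *m F by rewrite trmxC_mul trmxCK.
have hPI : (invmx (G *m G^t*))^t* = invmx (G *m G^t*).
  by rewrite trmx_inv map_invmx hP.
have hQI : (invmx (F^t* *m F))^t* = invmx (F^t* *m F).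
  by rewrite trmx_inv map_invmx hQ.
set PV := invmx _ in PI hPI; set QV := invmx _ in QI hQI.
exists (G^t* *m PV *m QV *m F^t*).
have MX : M *m (G^t* *m PV *m QV *m F^t*) = F *m QV *m F^t*.
  by rewrite MFG !mulmxA -(mulmxA F G) -(mulmxA F _ PV) PI mulmx1.
have XM : (G^t* *m PV *m QV *m F^t*) *m M = G^t* *m PV *m G.
  by rewrite MFG !mulmxA -(mulmxA _ _ F) -(mulmxA _ QV) QI mulmx1.
rewrite /penrose MX XM; apply/and4P; split; apply/eqP.
- by rewrite {1}MFG !mulmxA -(mulmxA _ _ F) -(mulmxA _ QV) QI mulmx1 MFG.
- by rewrite !mulmxA -(mulmxA _ G) -(mulmxA _ _ PV) PI mulmx1.
- by rewrite !trmxC_mul trmxCK hQI mulmxA.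
- by rewrite !trmxC_mul trmxCK hPI mulmxA.
Qed.

Lemma penrose_uniq m n (M : 'M[C]_(m, n)) X Y :
  penrose M X -> penrose M Y -> X = Y.
Proof.
move=> /and4P[/eqP x1 /eqP x2 /eqP x3 /eqP x4].
move=> /and4P[/eqP y1 /eqP y2 /eqP y3 /eqP y4].
have e1 : M *m X = M *m Y.
  by rewrite -x3 -{1}y1 -mulmxA trmxC_mul x3 y3 mulmxA x1.
have e2 : X *m M = Y *m M.
  by rewrite -x4 -{1}y1 -(mulmxA M) mulmxA trmxC_mul x4 y4 -!mulmxA (mulmxA M) x1.
by rewrite -x2 -mulmxA e1 mulmxA e2 y2.
Qed.

Definition mpinv m n (M : 'M[C]_(m, n)) : 'M[C]_(n, m) :=
  xchoose (penrose_exists M).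

Lemma mpinvP m n (M : 'M[C]_(m, n)) : penrose M (mpinv M).
Proof. exact: xchooseP. Qed.

End MoorePenrose.

Notation "M ^†" := (mpinv M) (at level 3, left associativity, format "M ^†") : ring_scope.

Section Drazin.
Variables (C : numClosedFieldType) (n : nat).
Implicit Types A B X : 'M[C]_n.

Lemma mxindex_exists A : exists k, \rank (A ^+ k.+1) == \rank (A ^+ k).
Proof.
have H m : (exists k, \rank (A ^+ k.+1) == \rank (A ^+ k))
           \/ (\rank (A ^+ m) + m <= n)%N.
  elim: m => [|m [|IHm]]; [| by left |].
    by right; rewrite addn0 rank_leq_row.
  have [E|NE] := eqVneq (\rank (A ^+ m.+1)) (\rank (A ^+ m)).
    by left; exists m; rewrite E.
  right; rewrite addnS -addSn (leq_trans _ IHm) // leq_add2r ltn_neqAle NE /=.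
  by rewrite exprS; apply: mxrankM_maxr.
have [//|] := H n.+1; by rewrite leqNgt addnS ltnS leq_addl.
Qed.

Definition mxindex A : nat := ex_minn (mxindex_exists A).

(* [A ^+ k] is available for every n (0 included), since ['M[C]_n] is a
   possibly trivial ring whose product is [*m]. *)
Definition is_drazin A X : bool :=
  [&& X *m A *m X == X, A *m X == X *m A
    & X *m A ^+ (mxindex A).+1 == A ^+ mxindex A].

Lemma is_drazin_exists A : exists X, is_drazin A X.
Proof.
rewrite /is_drazin /mxindex; case: ex_minnP => k /eqP rkE _.
have [Z0 Z0E] : exists Z, A ^+ k = Z * A ^+ k.+1.
  apply/submxP; have := mxrank_leqif_sup (submxMl A (A ^+ k)).
  by rewrite -[A *m _]/(A * _) -exprS => /geq_leqif <-; rewrite rkE.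
have [W0 W0E] : exists W, A ^+ k = A ^+ k.+1 * W.
  have/submxP[V VE] : ((A ^+ k)^T <= (A ^+ k.+1)^T)%MS.
    have := mxrank_leqif_sup (submxMl A^T (A ^+ k)^T).
    rewrite -trmx_mul -[_ *m A]/(_ * A) -exprSr => /geq_leqif <-.
    by rewrite !mxrank_tr rkE.
  by exists V^T; rewrite -[LHS]trmxK VE trmx_mul trmxK.
have [Z ZE] : exists Z, A ^+ k = Z * A ^+ (k.+1 + k).
  exists (Z0 ^+ k.+1); elim: k.+1 => [|j IHj]; first by rewrite mul1r.
  rewrite {1}IHj exprSr -mulrA; congr (_ * _).
  have -> : A ^+ (j.+1 + k) = A ^+ k.+1 * A ^+ j.
    by rewrite -exprD addSnnS addnC.
  by rewrite mulrA -Z0E -exprD addnC.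
have [W WE] : exists W, A ^+ k = A ^+ (k.+1 + k) * W.
  exists (W0 ^+ k.+1); elim: k.+1 => [|j IHj]; first by rewrite mulr1.
  rewrite {1}IHj exprS mulrA; congr (_ * _).
  have -> : A ^+ (j.+1 + k) = A ^+ j * A ^+ k.+1.
    by rewrite -exprD addSnnS.
  by rewrite -mulrA -W0E -exprD.
have XE : A ^+ k * W = Z * A ^+ k by rewrite {1}ZE -mulrA -WE.
have AX : A * (A ^+ k * W) = A ^+ k.+1 * W by rewrite mulrA -exprS.
have XA : A ^+ k * W * A = Z * A ^+ k.+1 by rewrite XE -mulrA -exprSr.
have ZW : Z * A ^+ k.+1 = A ^+ k.+1 * W.
  have AW : A ^+ k.+1 = A ^+ (k.+1 + k) * (A * W).
    by rewrite exprS {1}WE !mulrA -exprS exprSr.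
  by rewrite {1}AW mulrA -ZE mulrA -exprSr.
exists (A ^+ k * W); rewrite -![_ *m _]/(_ * _).
apply/and3P; split; apply/eqP.
- by rewrite XA -mulrA [A ^+ k.+1 * _]mulrA -exprD mulrA -ZE.
- by rewrite AX XA.
- by rewrite XE -mulrA -exprD addnC -ZE.
Qed.

Lemma is_drazin_uniq A X Y : is_drazin A X -> is_drazin A Y -> X = Y.
Proof.
rewrite /is_drazin; set k := mxindex A.
have pow Z : Z * A * Z = Z -> A * Z = Z * A ->
    Z = Z ^+ k.+1 * A ^+ k /\ Z = A ^+ k * Z ^+ k.+1.
  move=> ZAZ AZ; have cZA : GRing.comm Z A by rewrite /GRing.comm AZ.
  suff E : Z = Z ^+ k.+1 * A ^+ k.
    by split=> //; rewrite {1}E; apply/commrX/commr_sym/commrX/commr_sym.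
  elim: k => [|j IHj]; first by rewrite mulr1.
  have ZZA : Z = Z * (Z * A) by rewrite -AZ mulrA ZAZ.
  by rewrite {1}IHj (exprSr Z j) {2}ZZA (exprS A) !(exprSr Z) !mulrA.
move=> /and3P[/eqP x1 /eqP x2 /eqP x3] /and3P[/eqP y1 /eqP y2 /eqP y3].
have [XX _] := pow X x1 x2; have [_ YY] := pow Y y1 y2.
have cAY : GRing.comm (A ^+ k.+1) Y by apply/commr_sym/commrX/esym/y2.
have XAY : X * A * Y = X.
  by rewrite {1}XX -(mulrA _ _ A) -exprSr -mulrA cAY [Y * _]y3 -XX.
by rewrite -XAY {1}YY mulrA -(mulrA X) -exprS [X * _]x3 -YY.
Qed.

Definition drazin A : 'M[C]_n := xchoose (is_drazin_exists A).

Lemma drazinP A : is_drazin A (drazin A).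
Proof. exact: xchooseP. Qed.

Definition core_ep A : 'M[C]_n :=
  let k := mxindex A in
  A ^+ k *m (A^t* ^+ k *m A ^+ k.+1)^† *m A^t* ^+ k.

(* A^(B), the generalized inverse of A with respect to B. *)
Definition ginv_wrt A B : 'M[C]_n := (A *m B *m B^†)^†.

End Drazin.

(* Main.v *)
Require Import Defs.
From mathcomp Require Import all_boot all_order all_algebra.
From mathcomp Require Import complex reals.

(** Write [D] for the Drazin inverse of [A] and [E = A D = D A], which is an
    idempotent.  Everything takes place on the common range of [E], [D] and
    [A ^+ k].  A product [M M^†] is the orthogonal projector onto the range
    of [M], so it is the same matrix [P] for these three choices of [M]
    ([mulmx_mpinv_eq]).

    Put [Y = D E^†].  Since [D = D E], also [Y = D P]; hence [A Y = P] and
    [Y A Y = Y].  The last two equations of the system say [A X = A Y] and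
    [X A = Y A], so every outer inverse [X] that satisfies them is
    [X A X = Y A X = Y A Y = Y] ([outer_inverse_uniq]).

    The range of [P] is invariant under [A], where [D] inverts [A]; therefore
    [(A P) (D P) = P = (D P) (A P)], which is Hermitian, and
    [(A P)^† = D P = Y] ([ginv_wrt_drazin]).

    As for the core-EP inverse [Z], with [B = A ^+ k] and
    [N = B^t* A B = B^t* A ^+ k.+1], the ranges of [N] and [B^t*] coincide, so
    [N N^†] fixes [B^t*]; cancelling [B^t*] in this equation gives [A Z = P].
    The columns of [Z] lie in the range of [E], so [Z = E Z = D A Z = D P = Y]
    ([core_ep_drazin]). *)

Set Implicit Arguments.
Unset Strict Implicit.
Unset Printing Implicit Defensive.

Import Order.TTheory GRing.Theory Num.Theory.
Local Open Scope ring_scope.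
Local Open Scope complex_scope.
Local Open Scope sesquilinear_scope.

Section MoorePenroseTheory.
Variable C : numClosedFieldType.

Lemma mpinvK m n (M : 'M[C]_(m, n)) : M *m M^† *m M = M.
Proof. by have /and4P[/eqP] := mpinvP M. Qed.

Lemma mpinv_outer m n (M : 'M[C]_(m, n)) : M^† *m M *m M^† = M^†.
Proof. by have /and4P[_ /eqP] := mpinvP M. Qed.

Lemma mulmx_mpinv_herm m n (M : 'M[C]_(m, n)) : (M *m M^†)^t* = M *m M^†.
Proof. by have /and4P[_ _ /eqP] := mpinvP M. Qed.

Lemma mpinv_uniq m n (M : 'M[C]_(m, n)) X : penrose M X -> M^† = X.
Proof. by move=> PX; apply: penrose_uniq (mpinvP M) PX. Qed.

(** Each of the two projectors absorbs the other from one side, because each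
    of the two ranges contains the other; taking adjoints of one absorption
    identity turns it into a second value of the same product. *)
Lemma mulmx_mpinv_eq m n p (M : 'M[C]_(m, n)) (N : 'M[C]_(m, p)) U V :
  M = N *m U -> N = M *m V -> M *m M^† = N *m N^†.
Proof.
move=> MU NV.
have NM : N *m N^† *m (M *m M^†) = M *m M^†.
  by rewrite {1}MU !mulmxA mpinvK -MU.
have MN : M *m M^† *m (N *m N^†) = N *m N^†.
  by rewrite {1}NV !mulmxA mpinvK -NV.
by rewrite -(mulmx_mpinv_herm M) -NM trmxC_mul !mulmx_mpinv_herm.
Qed.

(** The adjoint of the first Penrose equation; it shows that [M^t* *m M] and
    [M^t*] have the same range. *)
Lemma trmxC_mulmx_mpinv m n (M : 'M[C]_(m, n)) : M^t* *m (M *m M^†) = M^t*.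
Proof. by rewrite -mulmx_mpinv_herm -trmxC_mul mpinvK. Qed.

Lemma outer_inverse_uniq m n (A : 'M[C]_(m, n)) X Y :
  X *m A *m X = X -> Y *m A *m Y = Y -> A *m X = A *m Y -> X *m A = Y *m A ->
  X = Y.
Proof. by move=> XAX YAY AX XA; rewrite -XAX XA -mulmxA AX mulmxA YAY. Qed.

End MoorePenroseTheory.

Section DrazinTheory.
Variables (C : numClosedFieldType) (n : nat).
Implicit Types A : 'M[C]_n.

Lemma trmxC_exp A k : (A ^+ k)^t* = A^t* ^+ k.
Proof.
elim: k => [|k IHk]; first by rewrite !expr0 trmx1 map_mx1.
by rewrite exprS exprSr -IHk; apply: trmxC_mul.
Qed.

Lemma drazinC A : A *m drazin A = drazin A *m A.
Proof. by have /and3P[_ /eqP] := drazinP A. Qed.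

Lemma drazinK A : drazin A *m A *m drazin A = drazin A.
Proof. by have /and3P[/eqP] := drazinP A. Qed.

Lemma drazin_exp A : drazin A *m A ^+ (mxindex A).+1 = A ^+ mxindex A.
Proof. by have /and3P[_ _ /eqP] := drazinP A. Qed.

Lemma mulmx_drazin_idem A : A *m drazin A *m (A *m drazin A) = A *m drazin A.
Proof. by rewrite -mulmxA (mulmxA (drazin A)) drazinK. Qed.

Lemma mulmx_drazin_mul A : A *m drazin A *m drazin A = drazin A.
Proof. by rewrite drazinC drazinK. Qed.

Lemma mulmx_drazin_exp A :
  A *m drazin A *m A ^+ mxindex A = A ^+ mxindex A.
Proof. by rewrite drazinC -mulmxA -{2}drazin_exp exprS. Qed.

(** The idempotent [A D] equals its own power [A ^+ k.+1 D ^+ k.+1], so its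
    range is contained in that of [A ^+ k]. *)
Lemma mulmx_drazin_expl A k :
  A *m drazin A = A ^+ k *m (A *m drazin A ^+ k.+1).
Proof.
have AD : GRing.comm A (drazin A) by exact: drazinC.
have -> : A *m drazin A = (A * drazin A) ^+ k.+1.
  elim: k => [|k IHk]; first by rewrite expr1.
  by rewrite exprS -IHk; apply/esym/mulmx_drazin_idem.
by rewrite exprMn_comm // exprSr -mulrA.
Qed.

Lemma drazin_mpinv A :
  drazin A *m (drazin A)^† = A *m drazin A *m (A *m drazin A)^†.
Proof.
by apply: mulmx_mpinv_eq (esym (mulmx_drazin_mul A)) (drazinC A).
Qed.

Lemma exp_mxindex_mpinv A :
  A ^+ mxindex A *m (A ^+ mxindex A)^† = A *m drazin A *m (A *m drazin A)^†.
Proof.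
by apply: mulmx_mpinv_eq (esym (mulmx_drazin_exp A)) (mulmx_drazin_expl A _).
Qed.

Lemma drazin_mul_mpinv A :
  drazin A *m (A *m drazin A)^† =
  drazin A *m (A *m drazin A *m (A *m drazin A)^†).
Proof. by rewrite !mulmxA drazinK. Qed.

Lemma drazin_mpinv_outer A :
  let Y := drazin A *m (A *m drazin A)^† in Y *m A *m Y = Y.
Proof.
by rewrite /= -!mulmxA (mulmxA A) (mulmxA (_ ^†)) mpinv_outer.
Qed.

(** With [P] the projector onto the range of [A D], the matrix to invert is
    [A P]; the candidate [D P] satisfies [(A P) (D P) = P = (D P) (A P)], as
    [D] inverts [A] on that range. *)
Lemma ginv_wrt_drazin A :
  ginv_wrt A (drazin A) = drazin A *m (A *m drazin A)^†.
Proof.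
rewrite /ginv_wrt -mulmxA drazin_mpinv drazin_mul_mpinv; apply: mpinv_uniq.
set E := A *m drazin A; set P := E *m E^†.
have PE : P *m E = E by exact: mpinvK.
have EP : E *m P = P by rewrite /P mulmxA mulmx_drazin_idem.
have PD : P *m drazin A = drazin A by rewrite -mulmx_drazin_mul mulmxA PE.
have AE : A *m E = E *m A by rewrite /E -mulmxA -drazinC.
(* the range of [P] is that of [E], and [E] commutes with [A] *)
have PAP : P *m (A *m P) = A *m P.
  have -> : A *m P = E *m (A *m E^†) by rewrite mulmxA -AE /P mulmxA.
  by rewrite mulmxA PE.
have APDP : A *m P *m (drazin A *m P) = P.
  by rewrite -mulmxA (mulmxA P) PD mulmxA EP.
have DPAP : drazin A *m P *m (A *m P) = P.
  by rewrite -mulmxA PAP mulmxA -drazinC EP.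
rewrite /penrose APDP DPAP PAP mulmxA PD /P mulmx_mpinv_herm.
by rewrite !eqxx.
Qed.

(** [A Z] is [A B N^† B^t*] with [B = A ^+ k] and [N = B^t* A B], so that
    [B^t* (A Z) = N N^† B^t* = B^t*].  The columns of [A Z] lie in the range
    of [B], on which [B^t*] is injective; hence [A Z = B B^†]. *)
Lemma core_ep_mulmx A :
  A *m core_ep A = A *m drazin A *m (A *m drazin A)^†.
Proof.
rewrite -exp_mxindex_mpinv /core_ep -trmxC_exp.
set k := mxindex A; set B := A ^+ k.
set N := B^t* *m A ^+ k.+1.
have AB : A ^+ k.+1 = A *m B by exact: exprS.
have BA : A ^+ k.+1 = B *m A by exact: exprSr.
have BD : B = A ^+ k.+1 *m drazin A.
  rewrite {1}/B -drazin_exp; apply/esym.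
  by apply: commr_sym; apply: commrX; apply/esym/drazinC.
(* by [BD], the ranges of [N = B^t* *m A ^+ k.+1] and [B^t* *m B] coincide *)
have BN : B^t* = N *m (drazin A *m B^†).
  by rewrite /N !mulmxA -(mulmxA (B^t*)) -BD -mulmxA trmxC_mulmx_mpinv.
have NNB : N *m N^† *m B^t* = B^t* by rewrite BN mulmxA mpinvK.
(* multiplying [NNB] by the adjoint of [B^†] replaces [B^t*] by the
   projector onto the range of [B], which fixes [A ^+ k.+1] *)
have PB : (B^†)^t* *m B^t* = B *m B^†.
  by rewrite -trmxC_mul mulmx_mpinv_herm.
have := congr1 (mulmx ((B^†)^t*)) NNB.
by rewrite /N !mulmxA PB BA !mulmxA mpinvK -BA AB.
Qed.

Lemma core_ep_drazin A : core_ep A = drazin A *m (A *m drazin A)^†.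
Proof.
have EZ : A *m drazin A *m core_ep A = core_ep A.
  by rewrite /core_ep !mulmxA mulmx_drazin_exp.
by rewrite -EZ {1}drazinC -mulmxA core_ep_mulmx -drazin_mul_mpinv.
Qed.

End DrazinTheory.

Theorem theorem5p1 (R : realType) (n k : nat) (A : 'M[R[i]]_n)
    (indA : mxindex A = k) :
  (forall X : 'M[R[i]]_n,
     [/\ X *m A *m X = X,
         A *m X = A *m drazin A *m (A *m drazin A)^† &
         X *m A = drazin A *m (A *m drazin A)^† *m A]
     <-> X = core_ep A)
  /\ core_ep A = ginv_wrt A (drazin A)
  /\ ginv_wrt A (drazin A) = drazin A *m (A *m drazin A)^†.
Proof.
rewrite ginv_wrt_drazin core_ep_drazin; split=> // X.
have YAY := drazin_mpinv_outer A.
split=> [[XAX AX XA] | ->]; last by split; rewrite ?YAY ?mulmxA.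
by apply: outer_inverse_uniq XAX YAY _ XA; rewrite AX mulmxA.
Qed.
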